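(* Let $G=(V,A)$ be a minimally Eulerian digraph with $|V|=n>1$. Then there exist an ordering $v_1,\dots,v_n$ of $V$ and a decomposition of $A$ into $n$ pairwise arc-disjoint directed paths $P_1,\dots,P_n$ (whose arc sets partition $A$) such that each $P_i$ is a directed path from $v_i$ to $v_{i+1}$ (with $v_{n+1}:=v_1$) of length at most $\lceil f(n)\sqrt{n}\rceil$, where $f$ is a function satisfying $f(n) = (\log_2 n)^{\log_{3/2} 2 + o(1)}$ and $f(n)\le \tfrac{1}{2}\log_2^2 n$. In particular each $P_i$ has length at most $\lceil \tfrac12 \sqrt{n}\,\log_2^2 n\rceil$.
   Context: Digraphs are simple. A connected digraph is Eulerian if every vertex has indegree equal to outdegree. A digraph $G$ is minimally Eulerian if it is a connected Eulerian digraph that contains no proper connected Eulerian spanning subgraph; equivalently, for every directed cycle $C$ of $G$, the digraph $(V, A\setminus A(C))$ is disconnected. The length of a directed path is its number of arcs. $\log_2^2 n$ means $(\log_2 n)^2$. *)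

(* Defs.v *)
From Stdlib Require Import Reals ZArith.
From mathcomp Require Import all_boot.
Set Implicit Arguments. Unset Strict Implicit. Unset Printing Implicit Defensive.

(* A simple digraph on a finite vertex type V: an irreflexive arc relation
   (no loops; no parallel arcs automatically since arcs are a relation). *)
Definition simple_digraph (V : finType) (a : rel V) : Prop :=
  forall v : V, ~~ a v v.

Definition indeg (V : finType) (a : rel V) (v : V) : nat := #|[set u | a u v]|.
Definition outdeg (V : finType) (a : rel V) (v : V) : nat := #|[set w | a v w]|.

Definition dconnected (V : finType) (a : rel V) : Prop :=
  forall u v : V, connect (fun x y => a x y || a y x) u v.

Definition eulerian (V : finType) (a : rel V) : Prop :=
  dconnected a /\ forall v : V, indeg a v = outdeg a v.

Definition arc_subrel (V : finType) (b a : rel V) : Prop :=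
  forall u v : V, b u v -> a u v.

Definition minimally_eulerian (V : finType) (a : rel V) : Prop :=
  eulerian a /\
  forall b : rel V, arc_subrel b a -> eulerian b -> forall u v : V, b u v = a u v.

Definition walk_arcs (V : finType) (x : V) (p : seq V) : seq (V * V) :=
  zip (x :: p) p.

(* x :: p is a directed path (no repeated vertices) from x to y in a;
   its length (number of arcs) is size p *)
Definition dpath_from_to (V : finType) (a : rel V) (x y : V) (p : seq V) : Prop :=
  path a x p /\ uniq (x :: p) /\ last x p = y.

Open Scope R_scope.
Definition log2 (x : R) : R := ln x / ln 2.
Definition Rceil (x : R) : Z := (- Int_part (- x))%Z.
Close Scope R_scope.

(* Main.v *)
Require Import Defs.
From Stdlib Require Import Reals ZArith Classical Lra.
From mathcomp Require Import all_boot perm zify.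
Set Implicit Arguments. Unset Strict Implicit. Unset Printing Implicit Defensive.

(* Fix an Euler tour and pick one occurrence of each vertex on it; the paths are
   the pieces between consecutive picked occurrences. They repeat no vertex: a
   closed piece of the tour contains all occurrences of some vertex, since
   otherwise it could be deleted, against minimality.

   To make all pieces short, cut the tour into segments of length about
   [10 sqrt n] and use Hall's theorem to give each segment its own vertex; then
   pieces have length at most about [30 sqrt n], without any logarithm. Suppose
   Hall's condition fails: [s] segments meet only [t < s] vertices. By
   minimality at most [t] arc-disjoint cycles live on these vertices, so deleting
   few short cycles leaves an arc set [R] of large girth. Growing balls from a
   vertex gives sparse cuts of [R], hence (as in Fox, Keevash and Sudakov) an
   order of the [t] vertices with [O(t)] backward arcs. Being a union of [s]
   trails up to closed walks, [R] has at most [O(t) + s] arcs forward across each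
   initial interval. In a simple digraph this leaves [O(t sqrt n)] arcs,
   fewer than the [s] segments contain.

   A bound [40 sqrt n] is below [f n * sqrt n] for [n >= 2048], and for smaller
   [n] the trivial bound [n - 1] suffices. *)

(** * Hall's marriage theorem *)

(** Induction on [#|D|]. If a proper nonempty [S] is tight, match it alone, and match [D :\: S]
    outside the neighbours of [S]. If none is tight, [j0] may take any neighbour, since deleting one
    vertex keeps Hall's condition for the rest. The value [v0] only serves the empty [D]. *)
Lemma hall_in (J V : finType) (v0 : V) (D : {set J}) (N : J -> {set V}) :
  (forall S : {set J}, S \subset D -> #|S| <= #|\bigcup_(j in S) N j|) ->
  exists g : J -> V, {in D &, injective g} /\ {in D, forall j, g j \in N j}.
Proof.
have [k] := ubnP #|D|; elim: k D N => // k IH D N leDk hN.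
have [->|[j0 j0D]] := set_0Vmem D.
  by exists (fun _ => v0); split=> [x y|x]; rewrite inE.
have [/existsP[S /and4P[SD S0 SnD /eqP cS]]|noS] := boolP [exists S : {set J},
   [&& S \subset D, S != set0, S != D & #|\bigcup_(j in S) N j| == #|S|]].
  have ltSD : #|S| < #|D| by apply: proper_card; rewrite properEneq SnD.
  have [|g1 [g1i g1N]] := IH S N (leq_trans ltSD (ltnSE leDk)).
    by move=> S' S'S; apply: hN; apply: subset_trans SD.
  pose N' j := N j :\: \bigcup_(i in S) N i.
  have cDS : #|D :\: S| < k.
    apply: leq_trans (ltnSE leDk); rewrite cardsD (setIidPr SD).
    by move: S0; rewrite -card_gt0; move: ltSD; lia.
  have [|g2 [g2i g2N]] := IH (D :\: S) N' cDS.
    move=> S' S'D.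
    have /hN : S' :|: S \subset D.
      by rewrite subUset SD andbT; apply: subset_trans S'D (subsetDl _ _).
    have dS : [disjoint S' & S].
      rewrite disjoints_subset; apply: subset_trans S'D _.
      by apply/subsetP=> x; rewrite !inE => /andP[].
    rewrite cardsU disjoint_setI0 // cards0 subn0 -cS => h.
    have : #|\bigcup_(j in S' :|: S) N j| <=
       #|\bigcup_(j in S') N' j| + #|\bigcup_(j in S) N j|.
      apply: leq_trans (leq_card_setU _ _); apply: subset_leq_card.
      apply/bigcupsP => j; rewrite inE => /orP[jS'|jS]; apply/subsetP => x xN.
        rewrite inE; have [|xS] := boolP (x \in \bigcup_(i in S) N i); first by rewrite orbT.
        by rewrite orbF; apply/bigcupP; exists j => //; rewrite !inE xS.
      by rewrite inE; apply/orP; right; apply/bigcupP; exists j.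
    by move: h; lia.
  exists (fun j => if j \in S then g1 j else g2 j); split.
    have h12 x y : x \in S -> y \in D -> y \notin S -> g1 x <> g2 y.
      move=> xS yD yS e12; have := g2N y; rewrite !inE yS yD => /(_ isT)/andP[+ _].
      by rewrite -e12 => /bigcupP[]; exists x => //; apply: g1N.
    move=> x y xD yD; case: ifPn => xS; case: ifPn => yS.
    - exact: g1i.
    - by move/h12; case.
    - by move/esym/h12; case.
    - by apply: g2i; rewrite inE ?xS ?yS.
  move=> x xD; case: ifPn => xS; first exact: g1N.
  by have := g2N x; rewrite !inE xS xD => /(_ isT)/andP[].
have /hN : [set j0] \subset D by rewrite sub1set.
rewrite cards1 big_set1 => /card_gt0P[x xN].
have [||g [gi gN]] := IH (D :\ j0) (fun j => N j :\ x).
- by move: leDk; rewrite (cardsD1 j0 D) j0D; lia.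
- move=> S SD; have [->|S0] := eqVneq S set0; first by rewrite cards0.
  have SD' : S \subset D by apply: subset_trans SD (subsetDl _ _).
  have SnD : S != D.
    by apply: contraTneq j0D => <-; apply/negP => /(subsetP SD); rewrite !inE eqxx.
  have := hN S SD'; move/existsPn: noS => /(_ S); rewrite SD' S0 SnD /=.
  have : #|\bigcup_(j in S) N j| <= #|\bigcup_(j in S) (N j :\ x)| + #|[set x]|.
    apply: leq_trans (leq_card_setU _ _); apply: subset_leq_card.
    apply/bigcupsP => j jS; apply/subsetP => y yN; rewrite !inE.
    have [|yx] := eqVneq y x; first by rewrite orbT.
    by rewrite orbF; apply/bigcupP; exists j => //; rewrite !inE yx.
  by rewrite cards1; lia.
exists (fun j => if j == j0 then x else g j); split.
  have h12 y : y \in D -> y != j0 -> x <> g y.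
    by move=> yD y0 e; have := gN y; rewrite !inE y0 yD -e eqxx => /(_ isT).
  move=> y z yD zD; case: eqVneq => [->|y0]; case: eqVneq => [->|z0] //.
  - by move/h12; case.
  - by move/esym/h12; case.
  - by apply: gi; rewrite !inE ?y0 ?z0.
move=> y yD; case: eqVneq => [->//|y0].
by have := gN y; rewrite !inE y0 yD => /(_ isT)/andP[].
Qed.

Lemma hall (J V : finType) (v0 : V) (N : J -> {set V}) :
  (forall S : {set J}, #|S| <= #|\bigcup_(j in S) N j|) ->
  exists g : J -> V, injective g /\ forall j, g j \in N j.
Proof.
move=> hN; have [//|g [gi gN]] := @hall_in J V v0 setT N.
by exists g; split=> [x y|j]; [apply: gi | apply: gN]; rewrite inE.
Qed.

(** * Euler tours *)

(** With heads for [f] and tails for [g], this pairs each arc entering a vertex with one leaving it.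
    An element goes to the one of the same rank in the equinumerous fibre of [g]. *)
Lemma perm_of_fibers (T V : finType) (f g : T -> V) :
  (forall v, #|[set x | f x == v]| = #|[set x | g x == v]|) ->
  exists s : {perm T}, forall x, g (s x) = f x.
Proof.
move=> hfg; pose F v := enum [set x | f x == v]; pose G v := enum [set x | g x == v].
have lt x : index x (F (f x)) < size (G (f x)).
  by rewrite -cardE -hfg cardE index_mem mem_enum inE.
pose h x := nth x (G (f x)) (index x (F (f x))).
have gh x : g (h x) = f x.
  by have := mem_nth x (lt x); rewrite mem_enum inE => /eqP.
have hi : injective h.
  move=> x y exy; have fxy : f x = f y by rewrite -!gh exy.
  move: exy (lt y); rewrite /h fxy (set_nth_default y) -?fxy ?lt // => /eqP + lty.
  rewrite nth_uniq ?enum_uniq // ?fxy -?[X in index x _ < size (G X)]fxy ?lt // => /eqP e.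
  by apply: (@index_inj _ _ (F (f y))) => //; rewrite ?mem_enum ?inE ?fxy.
by exists (perm hi) => x; rewrite permE gh.
Qed.

Definition balanced (V : finType) (E : {set V * V}) :=
  forall v, \sum_(e in E) (e.1 == v) = \sum_(e in E) (e.2 == v).

Definition link (V : finType) (E : {set V * V}) : rel V :=
  fun x y => ((x, y) \in E) || ((y, x) \in E).

Lemma link_sym (V : finType) (E : {set V * V}) : connect_sym (link E).
Proof. by apply: sym_connect_sym => x y; rewrite /link orbC. Qed.

Lemma balanced_perm (V : finType) (E : {set V * V}) : balanced E ->
  exists s : {perm {e | e \in E}}, forall e, (val (s e)).1 = (val e).2.
Proof.
move=> bE; apply: (@perm_of_fibers _ V (fun e => (val e).2) (fun e => (val e).1)) => v.
have card (p : pred (V * V)) :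
    #|[set e : {e | e \in E} | p (val e)]| = \sum_(e in E) p e.
  rewrite -(card_imset _ val_inj) -sum1_card big_mkcond [RHS]big_mkcond /=.
  apply: eq_bigr => e _; case: ifPn => [/imsetP[x]|he].
    by rewrite inE => px ->; rewrite (valP x) px.
  case: ifPn => // eE; case pe: (p e) => //; case/negP: he.
  by apply/imsetP; exists (exist _ e eE); rewrite ?inE.
by rewrite (card (fun e => e.2 == v)) (card (fun e => e.1 == v)) bE.
Qed.

(* Exchanging the successors of two arcs with the same head merges their cycles,
   so a successor permutation with fewest cycles is a single cycle. *)
Lemma balanced_cyclic_perm (V : finType) (E : {set V * V}) : balanced E ->
  (forall u v, connect (link E) u v) ->
  exists s : {perm {e | e \in E}}, (forall e, (val (s e)).1 = (val e).2) /\
    forall e f, f \in porbit s e.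
Proof.
move=> bE cE; have [s0 hs0] := balanced_perm bE.
pose P (s : {perm {e | e \in E}}) := [forall e, (val (s e)).1 == (val e).2].
have Ps0 : P s0 by apply/forallP => e; rewrite hs0.
case: (arg_minnP (fun s => #|porbits s|) Ps0) => s Ps smin.
have hs e : (val (s e)).1 = (val e).2 by apply/eqP/(forallP Ps).
have head e f : (val e).2 = (val f).2 -> porbit s e = porbit s f.
  move=> ef; apply/eqP; rewrite eq_porbit_mem; apply/negPn/negP => nef.
  have nef' : e != f by apply: contraNneq nef => ->; apply: porbit_id.
  have := porbits_mul_tperm s e f; rewrite nef nef'.
  have : P (tperm e f * s)%g.
    apply/forallP => x; rewrite permM.
    by case: tpermP => [->|->|_ _]; rewrite hs ?ef.
  have aux a b : b <= a -> a + 2 = b + 1 -> False by lia.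
  by move/smin/aux.
have sorb e : porbit s (s e) = porbit s e by have := porbit_perm s 1 e; rewrite expg1.
(* All arcs at [v] lie on one cycle: an arc leaving [v] is preceded on its cycle by an arc entering
   [v], and [head] compares the latter. Connectivity then spreads this to all arcs. *)
have at_vertex (e f : {e | e \in E}) v : (val e).1 = v \/ (val e).2 = v ->
    (val f).1 = v \/ (val f).2 = v -> porbit s e = porbit s f.
  have toh x : (val x).1 = v \/ (val x).2 = v ->
     exists y, (val y).2 = v /\ porbit s y = porbit s x.
    case=> [xv|xv]; last by exists x.
    by exists ((s^-1)%g x); rewrite -hs permKV -sorb permKV.
  by move=> /toh[e' [e'v <-]] /toh[f' [f'v <-]]; apply: head; rewrite e'v.
exists s; split=> // e f.
suff key p x (d : {e | e \in E}) : (val d).1 = x \/ (val d).2 = x ->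
    path (link E) x p -> forall d' : {e | e \in E},
    (val d').1 = last x p -> porbit s d = porbit s d'.
  have /connectP[p pp lp] := cE (val e).1 (val f).1.
  by rewrite -eq_porbit_mem; apply/eqP/esym/(key p (val e).1) => //; left.
elim: p x d => [|y p IH] x d dx /=; first by move=> _ d' d'x; apply: at_vertex dx _; left.
move=> /andP[xy py] d' d'l.
have [g [gx gy]] : exists g : {e | e \in E},
    ((val g).1 = x \/ (val g).2 = x) /\ ((val g).1 = y \/ (val g).2 = y).
  by case/orP: xy => h; exists (exist (fun e => e \in E) (_, _) h) => /=; split; auto.
by rewrite (at_vertex _ _ _ dx gx); apply: (IH y).
Qed.

(** The closed tour is unrolled into an infinite periodic sequence, so that a piece running past the
    end of a turn is still an interval of positions. *)
Definition euler_tour (V : finType) (E : {set V * V}) (w : nat -> V) :=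
  [/\ forall k, w (k + #|E|) = w k,
      forall k, (w k, w k.+1) \in E,
      forall i j, i < #|E| -> j < #|E| -> (w i, w i.+1) = (w j, w j.+1) -> i = j,
      forall e, e \in E -> exists2 k, k < #|E| & e = (w k, w k.+1) &
      forall v, exists2 k, k < #|E| & w k = v].

Lemma euler_tour_exists (V : finType) (E : {set V * V}) : 1 < #|V| -> balanced E ->
  (forall u v, connect (link E) u v) -> exists w, euler_tour E w.
Proof.
move=> V1 bE cE; have [s [hs orb]] := balanced_cyclic_perm bE cE.
have out v : exists e : {e | e \in E}, (val e).1 = v.
  have [x xv] : exists x, x != v.
    have : 0 < #|[set~ v]| by rewrite cardsC1; move: V1; lia.
    by case/card_gt0P => x; rewrite !inE; exists x.
  have /connectP[[|y p] /= + lx] := cE v x; first by rewrite lx eqxx in xv.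
  move=> /andP[/orP[vy|yv] _]; first by exists (exist (fun e => e \in E) (_, _) vy).
  by exists (s (exist (fun e => e \in E) (_, _) yv)); rewrite hs.
have [v0 _] : exists v, v \in V by apply/card_gt0P; apply: ltnW.
have [e0 _] := out v0.
have cm : #|porbit s e0| = #|E|.
  rewrite (_ : porbit s e0 = setT) ?cardsT ?card_sig //.
  by apply/setP => x; rewrite orb inE.
have wE k : ((val (iter k s e0)).1, (val (iter k.+1 s e0)).1) = val (iter k s e0).
  by rewrite /= hs -surjective_pairing.
have surj e : exists2 k, k < #|E| & iter k s e0 = e.
  have : e \in traject s e0 #|porbit s e0| by rewrite -porbit_traject orb.
  by move/trajectP => [k]; rewrite cm; exists k.
exists (fun k => (val (iter k s e0)).1); split.
- by move=> k; rewrite iterD -cm iter_porbit.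
- by move=> k; rewrite wE (valP (iter k s e0)).
- move=> i j im jm; rewrite !wE => /val_inj e.
  have := uniq_traject_porbit s e0; rewrite cm => u.
  apply/eqP; rewrite -(nth_uniq e0 _ _ u) ?size_traject // !nth_traject //.
  by rewrite e.
- by move=> e eE; have [k km ke] := surj (exist (fun e => e \in E) e eE); exists k; rewrite // wE ke.
- move=> v; have [e <-] := out v; have [k km <-] := surj e; by exists k.
Qed.

(** * Minimality *)

(** The working form of minimality. It names an arc of [C] whose ends get separated, which is more
    usable than mere disconnectedness of [A :\: C]. *)
Definition irreducible (V : finType) (A : {set V * V}) :=
  forall C : {set V * V}, C \subset A -> C != set0 -> balanced C ->
  exists2 e, e \in C & ~~ connect (link (A :\: C)) e.1 e.2.

Lemma balancedD (V : finType) (A C : {set V * V}) :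
  C \subset A -> balanced A -> balanced C -> balanced (A :\: C).
Proof.
move=> CA bA bC v; have := bA v.
rewrite (big_setID C) [X in _ = X](big_setID C) /= (setIidPr CA) bC.
by move/addnI.
Qed.

Lemma balancedU (V : finType) (A C : {set V * V}) :
  [disjoint A & C] -> balanced A -> balanced C -> balanced (A :|: C).
Proof.
by move=> dAC bA bC v; rewrite !(eq_bigl _ _ (fun e => in_setU e A C)) !bigU //= bA bC.
Qed.

Lemma indeg_sum (V : finType) (a : rel V) v :
  indeg a v = \sum_(e in [set e : V * V | a e.1 e.2]) (e.2 == v).
Proof.
transitivity (\sum_x \sum_y (if a x y then nat_of_bool (y == v) else 0)).
  rewrite /indeg -sum1_card big_mkcond /=; apply: eq_bigr => x _.
  rewrite (bigD1 v) //= eqxx inE big1 ?addn0 // => y yv.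
  by rewrite (negPf yv); case: ifP.
by rewrite pair_bigA [RHS]big_mkcond; apply: eq_bigr => -[x y] _; rewrite inE.
Qed.

Lemma outdeg_sum (V : finType) (a : rel V) v :
  outdeg a v = \sum_(e in [set e : V * V | a e.1 e.2]) (e.1 == v).
Proof.
transitivity (\sum_y \sum_x (if a x y then nat_of_bool (x == v) else 0)).
  rewrite /outdeg -sum1_card big_mkcond /=; apply: eq_bigr => y _.
  rewrite (bigD1 v) //= eqxx inE big1 ?addn0 // => x xv.
  by rewrite (negPf xv); case: ifP.
rewrite exchange_big pair_bigA [RHS]big_mkcond.
by apply: eq_bigr => -[x y] _; rewrite inE.
Qed.

(** If every arc of [C] kept its ends linked in [A :\: C], then [A :\: C] would be connected and
    Eulerian, hence equal to [A] by minimality, and [C] would be empty. *)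
Lemma minimally_eulerian_arcs (V : finType) (a : rel V) :
  minimally_eulerian a ->
  let A := [set e : V * V | a e.1 e.2] in
  [/\ balanced A, forall u v, connect (link A) u v & irreducible A].
Proof.
move=> [[cn bal] mina] A.
have bA : balanced A by move=> v; rewrite -indeg_sum -outdeg_sum bal.
have lA : forall u v, connect (link A) u v.
  by move=> u v; rewrite (eq_connect (e' := fun x y => a x y || a y x)) // => x y; rewrite /link !inE.
split=> // C CA C0 bC; apply/exists_inP; apply: contraNT C0 => /exists_inPn hC.
pose b : rel V := fun x y => (x, y) \in A :\: C.
have bE : [set e : V * V | b e.1 e.2] = A :\: C.
  by apply/setP => -[x y]; rewrite !inE /b !inE.
have eb : eulerian b.
  split; last by move=> v; rewrite indeg_sum outdeg_sum bE balancedD.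
  move=> u v; rewrite -/(link _); have := lA u v; apply: connect_sub => x y.
  have hxy x' y' : (x', y') \in A -> connect (link (A :\: C)) x' y'.
    move=> xyA; have [xyC|xyC] := boolP ((x', y') \in C).
      by have := hC _ xyC; rewrite negbK.
    by apply: connect1; rewrite /link inE xyC xyA.
  by case/orP => /hxy //; rewrite link_sym.
have ba : forall u v, b u v = a u v.
  apply: mina => // x y; rewrite /b !inE => /andP[] //.
apply/eqP/setP => -[x y]; rewrite inE; apply/negP => xyC.
have := subsetP CA _ xyC; rewrite inE /= -ba /b inE xyC //.
Qed.

Lemma telescope_sum (f : nat -> nat) n :
  \sum_(k < n) f k + f n = \sum_(k < n) f k.+1 + f 0.
Proof.
elim: n => [|n IH]; first by rewrite !big_ord0.
by rewrite !big_ord_recr /= IH addnAC.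
Qed.

Definition warc (V : Type) (w : nat -> V) k := (w k, w k.+1).

Lemma tour_modn (V : finType) (A : {set V * V}) w k : euler_tour A w -> w (k %% #|A|) = w k.
Proof.
case=> per _ _ _ _; rewrite {2}(divn_eq k #|A|) addnC.
by elim: (k %/ #|A|) => [|q ->]; rewrite ?addn0 // mulSn addnCA [#|A| + _]addnC per.
Qed.

Lemma tour_arc_modn (V : finType) (A : {set V * V}) w k : euler_tour A w ->
  warc w (k %% #|A|) = warc w k.
Proof.
move=> ew; rewrite /warc tour_modn //; congr (_, _).
by rewrite -(tour_modn _.+1 ew) -[RHS](tour_modn _ ew) -addn1 modnDml addn1.
Qed.

Lemma tour_arc_inj (V : finType) (A : {set V * V}) w i j : euler_tour A w ->
  warc w i = warc w j -> i = j %[mod #|A|].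
Proof.
move=> ew; rewrite -(tour_arc_modn i ew) -(tour_arc_modn j ew).
have [_ wA inj _ _] := ew.
have m0 : 0 < #|A| by apply/card_gt0P; exists (w 0, w 1).
by apply: inj; rewrite ltn_mod.
Qed.

Lemma modn_window m x i j : i < m -> j < m -> x + i = x + j %[mod m] -> i = j.
Proof.
by move=> im jm /eqP; rewrite eqn_modDl !modn_small // => /eqP.
Qed.

Definition walk_set (V : finType) (w : nat -> V) x n : {set V * V} :=
  [set warc w (x + k) | k : 'I_n].

Lemma walk_set_sum (V : finType) (A : {set V * V}) w x n (F : V * V -> nat) :
  euler_tour A w -> n <= #|A| ->
  \sum_(e in walk_set w x n) F e = \sum_(k < n) F (warc w (x + k)).
Proof.
move=> ew nm; rewrite big_imset //= => i j _ _ /(tour_arc_inj ew) e; apply: val_inj.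
by apply: modn_window e; apply: leq_trans nm.
Qed.

Lemma closed_walk_balanced (V : finType) (A : {set V * V}) w x n :
  euler_tour A w -> n <= #|A| -> w x = w (x + n) -> balanced (walk_set w x n).
Proof.
move=> ew nm wx v; rewrite !(walk_set_sum _ _ ew nm) /=.
have := telescope_sum (fun k => nat_of_bool (w (x + k) == v)) n.
rewrite addn0 -wx => /addIn ->; by apply: eq_bigr => k _; rewrite addnS.
Qed.

(* Deleting a closed piece of the tour leaves a closed walk, which would
   contradict irreducibility if it still visited every vertex. *)
Lemma closed_subwalk_private (V : finType) (A : {set V * V}) w x n :
  irreducible A -> euler_tour A w -> 0 < n < #|A| -> w x = w (x + n) ->
  exists u, forall k, k < #|A| -> w (x + k) = u -> 0 < k < n.
Proof.
move=> irr ew /andP[n0 nm] wx.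
have [per wA inj _ _] := ew.
have [||e] := irr (walk_set w x n) _ _ (closed_walk_balanced ew (ltnW nm) wx).
- by apply/subsetP => _ /imsetP[k _ ->]; apply: wA.
- by apply/set0Pn; exists (warc w (x + Ordinal n0)); apply: imset_f.
set B := A :\: _ => eC nc.
have step k : n <= k < #|A| -> link B (w (x + k)) (w (x + k).+1).
  move=> /andP[nk km]; rewrite /link inE wA andbT; apply/orP; left.
  apply/imsetP => -[j _ /(tour_arc_inj ew)/modn_window ej].
  by have jn := ltn_ord j; have := ej km (ltn_trans jn nm); lia.
(* The rest of the turn uses no deleted arc, so its vertices all stay linked to [w x]. A vertex cut
   off from [w x] thus occurs only strictly inside the closed piece. *)
have reach k : n <= k <= #|A| -> connect (link B) (w x) (w (x + k)).
  elim: k => [|k IH]; first by rewrite leqn0 => /andP[/eqP n00]; rewrite n00 in n0.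
  move=> /andP[]; rewrite leq_eqVlt => /orP[/eqP <- _|nk km]; first by rewrite -wx.
  rewrite addnS; apply: connect_trans (IH _) (connect1 (step _ _)); lia.
have nreach : exists u, ~~ connect (link B) (w x) u.
  case: (boolP (connect (link B) (w x) e.1)) => h1; last by exists e.1.
  exists e.2; apply: contra nc; apply: connect_trans.
  by rewrite link_sym.
have [u nu] := nreach; exists u => k km wk; apply/andP; split.
  by rewrite lt0n; apply: contraNneq nu => k0; rewrite -wk k0 addn0.
by rewrite ltnNge; apply: contra nu => nk; rewrite -wk; apply: reach; rewrite nk ltnW.
Qed.

(** * Digraphs of large girth have few backward arcs *)

Definition ball (V : finType) (e : rel V) (X : {set V}) v i : {set V} :=
  iter i (fun B => B :|: [set y in X | [exists x in B, e x y]]) [set v].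
Arguments ball : simpl never.

Lemma ballS (V : finType) (e : rel V) (X : {set V}) v i :
  ball e X v i.+1 =
  ball e X v i :|: [set y in X | [exists x in ball e X v i, e x y]].
Proof. by []. Qed.

Definition arcs_between (V : finType) (e : rel V) (Y Z : {set V}) : {set V * V} :=
  [set p | [&& p.1 \in Y, p.2 \in Z & e p.1 p.2]].

Lemma ball_sub (V : finType) (e : rel V) (X : {set V}) v i j :
  i <= j -> ball e X v i \subset ball e X v j.
Proof.
elim: j => [|j IH]; first by rewrite leqn0 => /eqP->.
rewrite leq_eqVlt => /orP[/eqP->//|/IH h].
exact: subset_trans h (subsetUl _ _).
Qed.

Lemma ball_sub_carrier (V : finType) (e : rel V) (X : {set V}) v i :
  v \in X -> ball e X v i \subset X.
Proof.
move=> vX; elim: i => [|i IH]; first by rewrite sub1set.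
by rewrite ballS subUset IH; apply/subsetP => y; rewrite inE => /andP[].
Qed.

Lemma ball_path (V : finType) (e : rel V) (X : {set V}) v i u : u \in ball e X v i ->
  exists p, [/\ path e v p, last v p = u & size p <= i].
Proof.
elim: i u => [|i IH] u; first by rewrite inE => /eqP->; exists [::].
rewrite ballS !inE => /orP[/IH[p [pp lp sp]]|/andP[uX /exists_inP[x /IH[p [pp lp sp]] xu]]].
  by exists p; rewrite pp lp leqW.
by exists (rcons p u); rewrite rcons_path pp lp xu last_rcons size_rcons.
Qed.

Lemma ball_step (V : finType) (e : rel V) (X : {set V}) v i x y :
  x \in ball e X v i -> y \in X -> e x y -> y \in ball e X v i.+1.
Proof.
move=> xB yX exy; rewrite ballS inE [X in _ || X]inE yX.
by apply/orP; right; apply/exists_inP; exists x.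
Qed.

(** An arc leaving a ball starts in its outermost sphere and ends in the next sphere; as there are
    no parallel arcs, the product of the sphere sizes bounds their number. *)
Lemma ball_boundary (V : finType) (e : rel V) (X : {set V}) v i :
  #|arcs_between e (ball e X v i.+1) (X :\: ball e X v i.+1)| <=
  (#|ball e X v i.+1| - #|ball e X v i|) * (#|ball e X v i.+2| - #|ball e X v i.+1|).
Proof.
rewrite -!cardsDS ?ball_sub // -cardsX; apply: subset_leq_card.
apply/subsetP => -[x y]; rewrite inE in_setX !in_setD /= => /and3P[xB /andP[yB yX] exy].
rewrite xB yB /= andbT; apply/andP; split; last exact: ball_step exy.
by apply: contra yB => xB'; apply: ball_step exy.
Qed.

(* If every sphere-to-sphere boundary were large, the ball sizes would grow like
   [b_{2j} >= |X| (j/q)^2] and the ball of radius [2q] would exhaust [X]. *)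
Lemma ball_cut (V : finType) (e : rel V) (X : {set V}) v q :
  v \in X -> 1 < #|X| -> #|X| <= q ^ 2 -> 2 * #|ball e X v (2 * q)| <= #|X|.+1 ->
  exists Y : {set V}, [/\ v \in Y, Y \subset X, 2 * #|Y| <= #|X|.+1 &
    4 * #|arcs_between e Y (X :\: Y)| * q ^ 2 <= 9 * #|Y| * #|X|].
Proof.
move=> vX X1 Xq hb; pose b i := #|ball e X v i|.
have q0 : 0 < q by case: q Xq {hb} X1 => //; case: #|X|.
have v_ball i : v \in ball e X v i.
  by apply: (subsetP (ball_sub e X v (leq0n i))); rewrite inE.
have bmono i j : i <= j -> b i <= b j by move=> ij; apply/subset_leq_card/ball_sub.
case: (pickP (fun i : 'I_(2 * q) =>
   4 * #|arcs_between e (ball e X v i) (X :\: ball e X v i)| * q ^ 2 <= 9 * b i * #|X|)) => [i hi|no].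
  exists (ball e X v i); split=> //; first exact: ball_sub_carrier.
  by apply: leq_trans hb; rewrite leq_mul2l bmono // ltnW.
suff key j : 0 < j <= q -> #|X| * j ^ 2 <= q ^ 2 * b (2 * j).
  have := key q; rewrite q0 leqnn mulnC leq_pmul2l ?expn_gt0 ?q0 // => /(_ isT).
  by move: hb X1; rewrite -/(b _); lia.
elim: j => // -[|j] IH /andP[_ jq].
  apply: leq_trans (_ : q ^ 2 <= _); first by rewrite muln1.
  by apply: leq_pmulr; apply/card_gt0P; exists v.
have {}IH : #|X| * j.+1 ^ 2 <= q ^ 2 * b (2 * j.+1) by apply: IH; exact: ltnW.
have lt : (2 * j.+1).+1 < 2 * q by lia.
have := no (Ordinal lt); rewrite /= -/(b _) => /negbT; rewrite -ltnNge.
have := ball_boundary e X v (2 * j.+1); rewrite -!/(b _).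
have := bmono (2 * j.+1) _ (leqnSn _); have := bmono (2 * j.+1).+1 _ (leqnSn _).
have -> : 2 * j.+2 = (2 * j.+1).+2 by lia.
move: IH; set i := j.+1.
move: (b (2 * i)) (b (2 * i).+1) (b (2 * i).+2) => b0 b1 b2.
set n := #|X|; move: #|_| => E IH h12 h01 hE hE2.
have -> : i.+1 ^ 2 = i ^ 2 + (2 * i + 1) by rewrite -mulnn -mulnn; lia.
(* By AM-GM the growth satisfies (b2 - b0)^2 >= 4 E, while 4 E > 9 b1 n / q^2 and b1 >= n i^2 / q^2.
   The resulting growth 3 n i / q^2 covers the increment of n i^2 / q^2, because 3 i >= 2 i + 1. *)
have hx : 3 * n * i < (b2 - b0) * q ^ 2.
  rewrite -ltn_sqr.
  have h1 : 9 * n * (n * i ^ 2) <= 9 * n * (q ^ 2 * b1).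
    by rewrite leq_mul2l; apply/orP; right; apply: leq_trans IH _; rewrite leq_mul2l h01 orbT.
  have h2 : 4 * E <= (b2 - b0) ^ 2.
    apply: (@leq_trans (4 * ((b1 - b0) * (b2 - b1)))); first by rewrite leq_mul2l.
    have -> : b2 - b0 = (b1 - b0) + (b2 - b1) by lia.
    by rewrite nat_AGM2.
  have h3 : q ^ 2 * (9 * b1 * n) < q ^ 2 * (4 * E * q ^ 2) by rewrite ltn_pmul2l ?expn_gt0 ?q0.
  have h4 : 4 * E * (q ^ 2 * q ^ 2) <= (b2 - b0) ^ 2 * (q ^ 2 * q ^ 2) by rewrite leq_mul2r h2 orbT.
  by rewrite !expnMn; move: h1 h3 h4; rewrite -!mulnn; lia.
have h5 : n * (2 * i + 1) <= 3 * n * i by rewrite /i; nia.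
have -> : b2 = b0 + (b2 - b0) by lia.
by rewrite !mulnDr mulnC [q ^ 2 * (b2 - b0)]mulnC; move: IH; lia.
Qed.

Definition rel_of (V : finType) (R : {set V * V}) : rel V := fun x y => (x, y) \in R.

Definition girth_gt (V : finType) (R : {set V * V}) r :=
  forall c : seq V, cycle (rel_of R) c -> uniq c -> 0 < size c -> r < size c.

Lemma closed_walk_cycle (V : finType) (e : rel V) x p :
  path e x p -> last x p = x -> p != [::] ->
  exists c, [/\ cycle e c, uniq c & 0 < size c <= size p].
Proof.
case: p => // y p /= /andP[exy py] lp _.
case/shortenP: py lp => p' pp' up' sp' lp'; exists (y :: p'); split=> //.
  by rewrite /= rcons_path pp' lp' exy.
by rewrite /= ltnS; apply: (uniq_leq_size _ sp'); case/andP: up'.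
Qed.

Lemma arcs_between_converse (V : finType) (e : rel V) Y Z :
  #|arcs_between (fun x y => e y x) Y Z| = #|arcs_between e Z Y|.
Proof.
pose sw (p : V * V) := (p.2, p.1).
have swI : injective sw by move=> [x y] [x' y'] [-> ->].
rewrite -(card_imset _ swI); apply: eq_card => -[x y].
apply/imsetP/idP => [[[x' y']]|]; rewrite !inE /=.
  by move=> /and3P[h1 h2 h3] [-> ->]; rewrite h1 h2 h3.
by move=> /and3P[h1 h2 h3]; exists (y, x); rewrite // inE /= h1 h2 h3.
Qed.

(** The out-ball and the in-ball of radius [2 * q] around [v] meet only in [v], since another common
    vertex would give a cycle of length at most [4 * q]. So one of them has at most about half of
    [X], and [ball_cut] applies to it. For the out-ball, [Y] is the complement of the set found,
    which reverses the cut as required. *)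
Lemma girth_cut (V : finType) (R : {set V * V}) (X : {set V}) q :
  girth_gt R (4 * q) -> 1 < #|X| -> #|X| <= q ^ 2 ->
  exists Y : {set V}, [/\ Y \subset X, Y != set0, Y != X &
    #|arcs_between (rel_of R) (X :\: Y) Y| * q ^ 2 <= 8 * #|Y| * #|X :\: Y|].
Proof.
move=> gR X1 Xq; have [v vX] : exists v, v \in X by apply/card_gt0P; apply: ltnW.
pose e := rel_of R; pose e' : rel V := fun x y => e y x.
have cap : ball e X v (2 * q) :&: ball e' X v (2 * q) \subset [set v].
  apply/subsetP => u; rewrite in_setI => /andP[/ball_path[p [pp lp sp]] /ball_path[p' [pp' lp' sp']]].
  rewrite inE; apply/negPn/negP => uv.
  have := pp'; rewrite -(rev_path e v p') lp' => pr.
  have lr : last u (rev (belast v p')) = v.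
    case: p' {pp' sp' pr} lp' => /= [vu|y p' _]; first by rewrite vu.
    by rewrite rev_cons last_rcons.
  have [|||c [cc uc /andP[c0 sc]]] := @closed_walk_cycle _ e v (p ++ rev (belast v p')).
  - by rewrite cat_path pp lp.
  - by rewrite last_cat lp lr.
  - by case: p {pp sp pr lr} lp => //= vu; rewrite vu eqxx in uv.
  have := gR c cc uc c0; rewrite ltnNge (leq_trans sc) //.
  by rewrite size_cat size_rev size_belast; lia.
have sum : #|ball e X v (2 * q)| + #|ball e' X v (2 * q)| <= #|X|.+1.
  rewrite -cardsUI -[#|X|.+1]addn1; apply: leq_add; last by rewrite (leq_trans (subset_leq_card cap)) ?cards1.
  by rewrite subset_leq_card // subUset !ball_sub_carrier.
(* Here b <= c + 1 <= 2 c, so b + c <= 3 c, and 27 / 4 is rounded up to 8. *)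
have arith (b c E : nat) : 2 * b <= (b + c).+1 -> 1 < b + c ->
   4 * E * q ^ 2 <= 9 * b * (b + c) -> E * q ^ 2 <= 8 * b * c.
  move=> h1 h2; have : b * (b + c) <= b * (3 * c) by rewrite leq_mul2l; apply/orP; right; lia.
  by move: (q ^ 2) => Q; lia.
have cardXD (Y : {set V}) : Y \subset X -> #|Y| + #|X :\: Y| = #|X|.
  by move=> YX; rewrite cardsDS // subnKC ?subset_leq_card.
have properY (Y : {set V}) : v \in Y -> 2 * #|Y| <= #|X|.+1 -> Y != set0 /\ Y != X.
  move=> vY hY; split; first by apply/set0Pn; exists v.
  by apply: contraTneq hY => ->; move: X1; lia.
case: (leqP (2 * #|ball e X v (2 * q)|) #|X|.+1) => hb.
  have [Y [vY YX hY cY]] := ball_cut vX X1 Xq hb; have [Y0 YnX] := properY Y vY hY.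
  have XXY : X :\: (X :\: Y) = Y by rewrite setDDr setDv set0U (setIidPr YX).
  exists (X :\: Y); split; first exact: subsetDl.
  - by apply: contraNneq YnX => XY0; rewrite -XXY XY0 setD0.
  - by apply: contraNneq Y0 => XY; rewrite -XXY XY setDv.
  - rewrite XXY -mulnA [#|_ :\: _| * _]mulnC mulnA; apply: arith => //; rewrite cardXD //.
have hb' : 2 * #|ball e' X v (2 * q)| <= #|X|.+1 by lia.
have [Y [vY YX hY cY]] := ball_cut vX X1 Xq hb'; have [Y0 YnX] := properY Y vY hY.
exists Y; split=> //; rewrite -arcs_between_converse; apply: arith; rewrite ?cardXD //.
Qed.

Definition back_arcs (V : finType) (R : {set V * V}) (s : seq V) : {set V * V} :=
  [set p in R | [&& p.1 \in s, p.2 \in s & index p.2 s < index p.1 s]].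

(** Order [Y] and [X :\: Y] recursively and put [Y] first; the new backward arcs are those of the
    cut. The bounds add up because 4 b^2 + 4 c^2 + 8 b c = 4 (b + c)^2. *)
Lemma few_back_arcs (V : finType) (R : {set V * V}) (X : {set V}) q :
  girth_gt R (4 * q) -> #|X| <= q ^ 2 ->
  exists s, [/\ uniq s, s =i X & #|back_arcs R s| * q ^ 2 <= 4 * #|X| ^ 2].
Proof.
move=> gR; have [k] := ubnP #|X|; elim: k X => // k IH X; rewrite ltnS => Xk Xq.
have [X1|X1] := leqP #|X| 1.
  exists (enum X); split; [exact: enum_uniq | by move=> x; rewrite mem_enum |].
  rewrite (_ : back_arcs _ _ = set0) ?cards0 //; apply/setP => -[x y].
  rewrite !inE /= !mem_enum; apply/negP => /and4P[_ xX yX].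
  by rewrite (card_le1_eqP X1 x y xX yX) ltnn.
have [Y [YX Y0 YnX cY]] := girth_cut gR X1 Xq.
have cXY : #|Y| + #|X :\: Y| = #|X| by rewrite cardsDS // subnKC ?subset_leq_card.
have ltYX : #|Y| < #|X| by apply: proper_card; rewrite properEneq YnX.
have Y0' : 0 < #|Y| by rewrite card_gt0.
have [||s1 [u1 m1 b1]] := IH Y; [lia | lia |].
have [||s2 [u2 m2 b2]] := IH (X :\: Y); [lia | lia |].
exists (s1 ++ s2); split.
- rewrite cat_uniq u1 u2 andbT; apply/hasPn => x; rewrite m2 inE => /andP[xY _].
  by rewrite m1.
- move=> x; rewrite mem_cat m1 m2 inE; have [/(subsetP YX)->//|//] := boolP (x \in Y).
have sub : back_arcs R (s1 ++ s2) \subset back_arcs R s1 :|: back_arcs R s2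
   :|: arcs_between (rel_of R) (X :\: Y) Y.
  apply/subsetP => -[x y]; rewrite !inE /rel_of /= !mem_cat !index_cat !m1 !m2 !inE.
  case: ((x, y) \in R) => //=.
  have lt z : z \in Y -> index z s1 < size s1 by rewrite index_mem m1.
  have [xY|xY] := boolP (x \in Y); have [yY|yY] := boolP (y \in Y) => //=.
  - by rewrite !orbF.
  - by have := lt _ xY; case: (y \in X) => //=; lia.
  - by case: (x \in X).
  - by rewrite ltn_add2l => ->.
have : #|back_arcs R (s1 ++ s2)| <= #|back_arcs R s1| + #|back_arcs R s2|
   + #|arcs_between (rel_of R) (X :\: Y) Y|.
  apply: leq_trans (subset_leq_card sub) _.
  by apply: leq_trans (leq_card_setU _ _) _; rewrite leq_add2r leq_card_setU.
rewrite -(leq_pmul2r (_ : 0 < q ^ 2)); last by apply: leq_trans Xq; lia.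
rewrite -cXY; move: b1 b2 cY; set c := #|X :\: Y|; rewrite -[(_ + c) ^ 2]mulnn -[_ ^ 2]mulnn -[c ^ 2]mulnn.
by move: (q ^ 2) => Q; lia.
Qed.

(** * Counting arcs on few vertices *)

Definition cycle_set (V : finType) (c : seq V) : {set V * V} :=
  [set (x, next c x) | x in c].

Lemma cycle_set_balanced (V : finType) (c : seq V) : uniq c -> balanced (cycle_set c).
Proof.
move=> uc v; have inj : {in c &, injective (fun x => (x, next c x))} by move=> x y _ _ [].
rewrite !big_imset //= (reindex_inj (can_inj (prev_next uc))).
by apply: eq_bigl => x; rewrite mem_next.
Qed.

Lemma cycle_set_sub (V : finType) (R : {set V * V}) c :
  cycle (rel_of R) c -> cycle_set c \subset R.
Proof. by move=> cc; apply/subsetP => _ /imsetP[x xc ->]; apply: (next_cycle cc). Qed.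

(* Each deleted cycle must join two components of the union of the previous ones
   (otherwise it could be deleted from [A]); [c] labels these components. *)
Lemma remove_short_cycles (V : finType) (A H : {set V * V}) (T : {set V}) r :
  irreducible A -> H \subset A -> (forall e, e \in H -> (e.1 \in T) && (e.2 \in T)) ->
  exists D : {set V * V}, [/\ D \subset H, balanced D, #|D| <= #|T| * r &
    girth_gt (H :\: D) r].
Proof.
move=> irr HA HT.
(* [k] bounds the number of labels left on [T]. Initially every vertex is its own label; each
   deleted cycle costs at most [r] arcs and merges two labels. *)
suff key k (D : {set V * V}) (c : V -> V) : D \subset H -> balanced D ->
    (forall x y, c x = c y -> connect (link D) x y) -> #|c @: T| <= k ->
    exists D' : {set V * V}, [/\ D' \subset H, balanced D', #|D'| <= #|D| + k * r &
      girth_gt (H :\: D') r].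
  have := key #|T| set0 id (sub0set _); rewrite cards0 imset_id; apply=> //.
    by move=> v; rewrite !big_set0.
  by move=> x y ->.
elim: k D c => [|k IH] D c DH bD cD cT.
  exists D; split; rewrite ?addn0 //; case=> // x p /= pp _ _.
  have [y xy] : exists y, (x, y) \in H.
    case: p pp => [|y p] /= /andP[]; rewrite /rel_of inE => /andP[_ h] _; first by exists x.
    by exists y.
  have /andP[/= xT _] := HT _ xy.
  by move: cT; rewrite leqn0 cards_eq0 imset_eq0 => /eqP T0; rewrite T0 inE in xT.
have [[p [pc pu p0 pr]]|no] := classic (exists p, [/\ cycle (rel_of (H :\: D)) p, uniq p,
    0 < size p & size p <= r]); last first.
  exists D; split; rewrite ?leq_addr // => p pc pu p0.
  by rewrite ltnNge; apply/negP => pr; apply: no; exists p.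
have CHD := cycle_set_sub pc; set C := cycle_set p in CHD.
have CH : C \subset H := subset_trans CHD (subsetDl _ _).
have dDC : [disjoint D & C].
  rewrite disjoint_sym disjoints_subset; apply: subset_trans CHD _.
  by apply/subsetP => e; rewrite !inE => /andP[].
have bC : balanced C := cycle_set_balanced pu.
have C0 : C != set0.
  case: p p0 @C {pc pu pr CHD CH dDC bC} => // x p _; apply/set0Pn; exists (x, next (x :: p) x).
  by apply: imset_f; apply: mem_head.
have [e eC ne] := irr C (subset_trans CH HA) C0 bC.
have DAC : D \subset A :\: C by rewrite subsetD (subset_trans DH HA) dDC.
have cne : c e.1 != c e.2.
  apply: contraNneq ne => /cD; apply: connect_sub => x y xy; apply: connect1.
  by case/orP: xy => /(subsetP DAC) h; rewrite /link h ?orbT.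
have /HT/andP[e1T e2T] := subsetP CH e eC.
pose c' x := if c x == c e.1 then c e.2 else c x.
have [||||D' [D'H bD' sD' gD']] := IH (D :|: C) c'.
- by rewrite subUset DH.
- exact: balancedU.
- have up x y : connect (link D) x y -> connect (link (D :|: C)) x y.
    apply: connect_sub => {}x {}y; rewrite /link => xy; apply: connect1.
    by rewrite !inE; case/orP: xy => ->; rewrite ?orbT.
  have cc : connect (link (D :|: C)) e.1 e.2.
    by apply: connect1; rewrite /link !inE -surjective_pairing eC orbT.
  move=> x y; rewrite /c'; case: eqP => cx; case: eqP => cy.
  + by move=> _; apply: up; apply: cD; rewrite cx.
  + move=> /cD/up; apply: connect_trans; apply: connect_trans cc.
    exact/up/cD.
  + move=> /cD/up h; apply: connect_trans h _; rewrite link_sym.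
    by apply: connect_trans cc; apply/up/cD.
  + by move/cD/up.
- rewrite -ltnS; apply: leq_trans cT; apply: proper_card; apply/properP; split.
    by apply/subsetP => _ /imsetP[x xT ->]; rewrite /c'; case: ifP => _; apply: imset_f.
  exists (c e.1); first exact: imset_f.
  apply/imsetP => -[x xT]; rewrite /c'; case: ifPn => [_ h|/eqP h h'].
    by rewrite h eqxx in cne.
  by apply: h.
exists D'; split=> //; apply: leq_trans sD' _.
have : #|C| <= r by apply: leq_trans (leq_imset_card _ _) _; apply: leq_trans (card_size p) _.
have : #|D :|: C| <= #|D| + #|C| by apply: leq_card_setU.
rewrite mulSn addnA => h1 h2; rewrite leq_add2r.
by apply: leq_trans h1 _; rewrite leq_add2l.
Qed.

Lemma balanced_cut (V : finType) (D : {set V * V}) (X : {set V}) :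
  balanced D -> \sum_(e in D) (e.1 \in X) = \sum_(e in D) (e.2 \in X).
Proof.
move=> bD; have mem x : nat_of_bool (x \in X) = \sum_(v in X) (x == v).
  have [xX|xX] := boolP (x \in X).
    by rewrite (bigD1 x) //= eqxx big1 ?addn0 // => y /andP[_ /negPf]; rewrite eq_sym => ->.
  by rewrite big1 // => y yX; case: eqP => // xy; rewrite xy yX in xX.
under eq_bigr do rewrite mem; under [RHS]eq_bigr do rewrite mem.
by rewrite exchange_big [RHS]exchange_big; apply: eq_bigr => v _; apply: bD.
Qed.

(* Cut the vertex order into [q] blocks of size [q]: an arc is backward, inside a
   block, or crosses one of the block boundaries forward. *)
Lemma few_arcs (V : finType) (R : {set V * V}) (T : {set V}) q s :
  0 < q -> #|T| <= q ^ 2 -> girth_gt R (4 * q) ->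
  (forall e, e \in R -> (e.1 \in T) && (e.2 \in T)) ->
  (forall X : {set V}, \sum_(e in R) (e.1 \in X) <= \sum_(e in R) (e.2 \in X) + s) ->
  #|R| <= 4 * #|T| + #|T| * q + q * (4 * #|T| + s).
Proof.
move=> q0 Tq gR RT cutR; have [o [uo mo bo]] := few_back_arcs gR Tq.
have b4 : #|back_arcs R o| <= 4 * #|T|.
  rewrite -(leq_pmul2r (_ : 0 < q ^ 2)) ?expn_gt0 ?q0 //; apply: leq_trans bo _.
  by rewrite -mulnn -mulnA leq_mul2l /= leq_mul2l Tq orbT.
pose ix x := index x o.
have ixlt x : x \in T -> ix x < #|T|.
  move=> xT; rewrite (_ : #|T| = size o) ?index_mem ?mo //.
  by rewrite -(card_uniqP uo); apply: eq_card.
pose cross (j : 'I_q) : {set V * V} := [set e in R | ix e.1 < j * q <= ix e.2].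
pose same : {set V * V} := [set e in R | ix e.1 %/ q == ix e.2 %/ q].
have cross_le j : #|cross j| <= 4 * #|T| + s.
  pose X := [set x in T | ix x < j * q].
  (* Forward arcs leaving the initial interval [X] exceed those entering it by the difference of
     tails and heads in [X], which is at most [s]; the entering arcs are backward. *)
  have e1 : \sum_(e in R) (e.1 \in X) + \sum_(e in R) ((e.1 \notin X) && (e.2 \in X)) =
      \sum_(e in R) (e.2 \in X) + \sum_(e in R) ((e.1 \in X) && (e.2 \notin X)).
    rewrite -!big_split /=; apply: eq_bigr => e _.
    by case: (e.1 \in X); case: (e.2 \in X).
  have card (p : pred (V * V)) : \sum_(e in R) p e = #|[set e in R | p e]|.
    rewrite -sum1_card big_mkcond [RHS]big_mkcond /=; apply: eq_bigr => e _.
    by rewrite inE; case: (e \in R); case: (p e).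
  have h1 : #|cross j| <= \sum_(e in R) ((e.1 \in X) && (e.2 \notin X)).
    rewrite (card (fun e => (e.1 \in X) && (e.2 \notin X))); apply/subset_leq_card/subsetP => e.
    rewrite !inE => /and3P[eR h1 h2]; have /andP[e1T e2T] := RT e eR.
    by rewrite eR e1T e2T h1 -leqNgt.
  have h2 : \sum_(e in R) ((e.1 \notin X) && (e.2 \in X)) <= #|back_arcs R o|.
    rewrite (card (fun e => (e.1 \notin X) && (e.2 \in X))); apply/subset_leq_card/subsetP => e.
    rewrite !inE => /and3P[eR]; have /andP[e1T e2T] := RT e eR.
    rewrite e1T e2T eR !mo e1T e2T /= -leqNgt => h3 h4.
    exact: leq_trans h4 h3.
  have := cutR X; move: e1 h1 h2 b4.
  set a := \sum_(e in R) _; set b := \sum_(e in R) _; set c := \sum_(e in R) _; set d := \sum_(e in R) _.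
  by lia.
have same_le : #|same| <= #|T| * q.
  (* An arc inside a block is determined by its tail and the place of its head within the block. *)
  pose h (e : V * V) : V * 'I_q := (e.1, Ordinal (ltn_pmod (ix e.2) q0)).
  rewrite -(card_in_imset (f := h)); last first.
    move=> [x y] [x' y']; rewrite !inE /= => /andP[eR /eqP d] /andP[eR' /eqP d'] [xx m].
    have /andP[_ /= yT] := RT _ eR; have /andP[_ /= yT'] := RT _ eR'.
    have iyy : ix y = ix y' by rewrite (divn_eq (ix y) q) -d m xx d' -divn_eq.
    by rewrite xx (index_inj x _ _ iyy) ?mo.
  rewrite -[q in _ * q]card_ord -cardsT -cardsX; apply/subset_leq_card/subsetP => _ /imsetP[e + ->].
  by rewrite inE => /andP[/RT/andP[eT _] _]; rewrite !inE eT.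
have cov : R \subset back_arcs R o :|: same :|: \bigcup_j cross j.
  apply/subsetP => e eR; have /andP[e1T e2T] := RT e eR.
  rewrite !inE eR !mo e1T e2T /=; have [//|le] := ltnP (index e.2 o) (index e.1 o).
  have [//|ne] := eqVneq; apply/bigcupP.
  have lt : ix e.1 %/ q < ix e.2 %/ q by rewrite ltn_neqAle ne leq_div2r.
  have jq : ix e.2 %/ q < q by rewrite ltn_divLR // mulnn; apply: leq_trans (ixlt _ e2T) Tq.
  exists (Ordinal jq) => //; rewrite inE eR /= leq_divM andbT.
  by rewrite -ltn_divLR.
apply: leq_trans (subset_leq_card cov) _; apply: leq_trans (leq_card_setU _ _) _.
apply: leq_add; first by apply: leq_trans (leq_card_setU _ _) _; apply: leq_add.
apply: leq_trans (_ : \sum_(j < q) #|cross j| <= _).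
  by elim/big_rec2: _ => [|j a b _ h]; rewrite ?cards0 // (leq_trans (leq_card_setU _ _)) ?leq_add2l.
apply: (@leq_trans (\sum_(j < q) (4 * #|T| + s))); first by apply: leq_sum => j _.
by rewrite sum_nat_const card_ord.
Qed.

(** * Distributing the vertices along the tour *)

Lemma segment_arcs_sum (V : finType) (A : {set V * V}) w l d k (J : {set 'I_k})
    (F : V * V -> nat) : euler_tour A w -> d <= l -> k * l <= #|A| ->
  \sum_(e in [set warc w ((x : 'I_k * 'I_d).1 * l + x.2) | x in setX J [set: 'I_d]]) F e =
  \sum_(j in J) \sum_(i < d) F (warc w (j * l + i)).
Proof.
move=> ew dl kl; rewrite big_imset /=; last first.
  move=> [j i] [j' i'] _ _ /= /(tour_arc_inj ew).
  have lt (a : 'I_k) (b : 'I_d) : a * l + b < #|A|.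
    apply: leq_trans kl; apply: leq_trans (_ : a.+1 * l <= _).
      by rewrite mulSn addnC ltn_add2r (leq_trans (ltn_ord b)).
    by rewrite leq_mul2r ltn_ord orbT.
  rewrite !modn_small // => e.
  have il : i < l := leq_trans (ltn_ord i) dl.
  have il' : i' < l := leq_trans (ltn_ord i') dl.
  have l0 : 0 < l by apply: leq_ltn_trans il.
  have ei : i = i' by apply: val_inj; rewrite /= -(modn_small il) -(modn_small il') -(modnMDl j) e modnMDl.
  have ej : j = j'.
    by apply: val_inj; move/eqP: e; rewrite ei eqn_add2r eqn_pmul2r // => /eqP.
  by rewrite ei ej.
rewrite pair_big_dep /=; apply: eq_bigl => -[j i].
by rewrite !inE andbT.
Qed.

Lemma segment_hall (V : finType) (A : {set V * V}) w q k :
  irreducible A -> euler_tour A w -> 0 < q -> #|V| <= q ^ 2 ->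
  let l := 10 * q + 5 in k * l <= #|A| ->
  exists g : 'I_k -> V, injective g /\
    forall j, g j \in [set w (j * l + i) | i : 'I_l].
Proof.
move=> irr ew q0 Vq l kl; apply: (hall (w 0)) => J.
set T := \bigcup_(j in J) _; rewrite leqNgt; apply/negP => TJ.
have wT (j : 'I_k) i : j \in J -> i < l -> w (j * l + i) \in T.
  by move=> jJ il; apply/bigcupP; exists j => //; apply/imsetP; exists (Ordinal il).
(* A segment of [l] positions contains [l - 1] arcs with both ends in it. *)
pose d := 10 * q + 4.
pose H : {set V * V} := [set warc w ((x : 'I_k * 'I_d).1 * l + x.2) | x in setX J [set: 'I_d]].
have Hsum F : \sum_(e in H) F e = \sum_(j in J) \sum_(i < d) F (warc w (j * l + i)).
  by apply: (segment_arcs_sum _ _ ew) => //; rewrite leq_add2l.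
have HA : H \subset A by case: ew => _ wA _ _ _; apply/subsetP => _ /imsetP[x _ ->]; apply: wA.
have HT e : e \in H -> (e.1 \in T) && (e.2 \in T).
  move=> /imsetP[[j i]]; rewrite !inE andbT => jJ -> /=.
  have il : i < 10 * q + 4 := ltn_ord i.
  by apply/andP; split; [|rewrite -addnS]; apply: wT => //; move: il; rewrite /l; clear; lia.
have [D [DH bD cD gD]] := remove_short_cycles (4 * q) irr HA HT.
have Tq : #|T| <= q ^ 2 by apply: leq_trans Vq; apply: max_card.
(* Along a single trail, tails in [X] outnumber heads in [X] by at most one; deleting the balanced
   [D] does not change the difference. *)
have cutR (X : {set V}) : \sum_(e in H :\: D) (e.1 \in X) <=
    \sum_(e in H :\: D) (e.2 \in X) + #|J|.
  have cutH : \sum_(e in H) (e.1 \in X) <= \sum_(e in H) (e.2 \in X) + #|J|.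
    rewrite !Hsum -sum1_card -big_split /=; apply: leq_sum => j _.
    have := telescope_sum (fun i => nat_of_bool (w (j * l + i) \in X)) d.
    rewrite /= => e; apply: leq_trans (leq_addr (w (j * l + d) \in X) _) _; rewrite e; apply: leq_add.
      by apply: leq_sum => i _; rewrite addnS.
    by case: (_ \in X).
  have sp (F : V * V -> nat) : \sum_(e in H) F e = \sum_(e in D) F e + \sum_(e in H :\: D) F e.
    by rewrite (big_setID D) /= (setIidPr DH).
  move: cutH; rewrite (sp (fun e => nat_of_bool (e.1 \in X))) (sp (fun e => nat_of_bool (e.2 \in X))).
  by rewrite (balanced_cut X bD) -addnA leq_add2l.
have RT e : e \in H :\: D -> (e.1 \in T) && (e.2 \in T) by rewrite inE => /andP[_ /HT].
have := few_arcs q0 Tq gD RT cutR.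
rewrite cardsD (setIidPr DH); apply/negP; rewrite -ltnNge.
have cH : #|H| = #|J| * d.
  by rewrite -sum1_card Hsum sum_nat_const sum1_card card_ord.
rewrite cH ltn_subRL; move: TJ cD; rewrite /d.
move: #|T| #|J| #|D| => t s D' ts cD'.
(* The deleted arcs and the bound of [few_arcs] total 4 t q + 4 t + t q + q (4 t + s) = 9 t q + 4 t
   + q s, which is below s (10 q + 4) as t < s. This is the source of the segment length. *)
have h : t * q <= s * q by rewrite leq_mul2r ltnW ?orbT.
have h2 : s * (10 * q + 4) = 10 * (s * q) + 4 * s by lia.
by rewrite h2; move: cD' h; lia.
Qed.

(** A vertex assigned to a segment is picked inside it, any other vertex anywhere. Nothing is
    claimed about the incomplete segment at the end of the turn. *)
Lemma spread_positions (V : finType) (A : {set V * V}) w q :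
  irreducible A -> euler_tour A w -> 0 < q -> #|V| <= q ^ 2 ->
  let l := 10 * q + 5 in
  exists pos : V -> nat, [/\ forall v, pos v < #|A|, forall v, w (pos v) = v &
    forall j, j < #|A| %/ l -> exists v, j * l <= pos v < j.+1 * l].
Proof.
move=> irr ew q0 Vq l; set k := #|A| %/ l.
have kl : k * l <= #|A| := leq_divM _ _.
have [g [gi gN]] := segment_hall irr ew q0 Vq kl.
have lk (j : 'I_k) i : i < l -> j * l + i < #|A|.
  move=> il; apply: leq_trans kl; apply: leq_trans (_ : j.+1 * l <= _).
    by rewrite mulSn addnC ltn_add2r.
  by rewrite leq_mul2r ltn_ord orbT.
have /fin_all_exists[pos hpos] (v : V) : exists p, [/\ p < #|A|, w p = v &
    forall j : 'I_k, g j = v -> j * l <= p < j.+1 * l].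
  case: (pickP (fun j : 'I_k => g j == v)) => [j /eqP gj|no].
    have /imsetP[i _ e] := gN j; exists (j * l + i); rewrite lk // -e gj; split=> //.
    move=> j'; rewrite -gj => /gi ->.
    by move: (nat_of_ord i) (ltn_ord i) => i0 i0l; rewrite leq_addr mulSn addnC ltn_add2r.
  have [_ _ _ _ /(_ v)[p pm wp]] := ew; exists p; split=> // j gj.
  by have := no j; rewrite gj eqxx.
exists pos; split=> [v|v|j jk]; try by case: (hpos v).
by exists (g (Ordinal jk)); case: (hpos (g (Ordinal jk))) => _ _ /(_ (Ordinal jk) erefl).
Qed.

Definition tour_piece (V : Type) (w : nat -> V) x d := [seq w k | k <- iota x.+1 d].

Lemma tour_piece_path (V : finType) (a : rel V) w x d :
  (forall k, a (w k) (w k.+1)) -> path a (w x) (tour_piece w x d).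
Proof. by move=> wa; rewrite /tour_piece; elim: d x => //= d IH x; rewrite wa IH. Qed.

Lemma tour_piece_last (V : finType) (w : nat -> V) x d :
  last (w x) (tour_piece w x d) = w (x + d).
Proof. by rewrite /tour_piece; elim: d x => [|d IH] x /=; rewrite ?addn0 // IH addSnnS. Qed.

Lemma tour_piece_arcs (V : finType) (w : nat -> V) x d :
  walk_arcs (w x) (tour_piece w x d) = [seq warc w k | k <- iota x d].
Proof.
rewrite /walk_arcs /tour_piece; elim: d x => [|d IH] x //=.
by rewrite IH.
Qed.

(** * Cutting the tour *)

(** A longer gap would contain the whole segment following that of [x], and this segment contains a
    point of [P]. *)
Lemma increasing_gap (m l : nat) (P : nat -> Prop) x y :
  0 < l -> y < m -> (forall j, j < m %/ l -> exists2 p, P p & j * l <= p < j.+1 * l) ->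
  (forall p, P p -> ~ (x < p < y)) -> y <= x + 2 * l.
Proof.
move=> l0 ym hP nP; rewrite leqNgt; apply/negP => lt.
have xl : x < (x %/ l).+1 * l by rewrite -ltn_divLR.
have xl' : x %/ l * l <= x := leq_divM _ _.
have e3 : (x %/ l).+3 * l = x %/ l * l + l + l + l by lia.
have e2 : (x %/ l).+2 * l = x %/ l * l + l + l by lia.
have e1 : (x %/ l).+1 * l = x %/ l * l + l by lia.
have jm : (x %/ l).+1 < m %/ l by rewrite leq_divRL // e2; lia.
have [p Pp /andP[p1 p2]] := hP _ jm.
by apply: (nP p Pp); rewrite (leq_trans xl p1) /=; move: p2; rewrite e2; lia.
Qed.

Lemma seq_sorted_by (V : finType) (pos : V -> nat) : injective pos ->
  exists s : seq V, [/\ uniq s, size s = #|V|, forall v, v \in s &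
    sorted (fun u v => pos u < pos v) s].
Proof.
move=> posI; pose r u v := pos u <= pos v.
exists (sort r (enum V)); have us : uniq (sort r (enum V)) by rewrite sort_uniq enum_uniq.
split=> //; [by rewrite size_sort cardE | by move=> v; rewrite mem_sort mem_enum |].
have tr : total r by move=> u v; apply: leq_total.
have : sorted ltn (map pos (sort r (enum V))).
  by rewrite ltn_sorted_uniq_leq map_inj_uniq // us sorted_map; apply: sort_sorted.
by rewrite sorted_map.
Qed.

Section Cut.
Variables (V : finType) (A : {set V * V}) (w : nat -> V) (pos : V -> nat) (v0 : V) (s : seq V).
Local Notation n := #|V|.
Local Notation m := #|A|.
Hypotheses (n1 : 1 < n) (irr : irreducible A) (ew : euler_tour A w)
  (posm : forall v, pos v < m) (wpos : forall v, w (pos v) = v)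
  (us : uniq s) (ss : size s = n) (sT : forall v, v \in s)
  (srt : sorted (fun u v => pos u < pos v) s).

(** The final cut is the first one shifted by a full turn, so the last piece closes the tour. *)
Definition cut i := if i < n then pos (nth v0 s i) else pos (nth v0 s 0) + m.

Lemma pos_lt i j : i < j -> j < n -> pos (nth v0 s i) < pos (nth v0 s j).
Proof.
have tr : transitive (fun u v => pos u < pos v) by move=> x y z; apply: ltn_trans.
by move=> ij jn; apply: (sorted_ltn_nth tr v0 srt); rewrite ?inE ?ss // (ltn_trans ij).
Qed.

Lemma cut_lt i : i < n -> cut i < cut i.+1.
Proof.
move=> lt; rewrite /cut lt; case: (ltnP i.+1 n) => h; first exact: pos_lt.
by apply: leq_trans (posm _) (leq_addl _ _).
Qed.

Lemma cut_span i : i < n -> cut i.+1 - cut i < m.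
Proof.
move=> lt; rewrite /cut lt; case: (ltnP i.+1 n) => h; first by have := posm (nth v0 s i.+1); lia.
have i0 : 0 < i by lia.
by have := pos_lt i0 lt; have := posm (nth v0 s 0); lia.
Qed.

Lemma w_cut i : i < n -> w (cut i) = nth v0 s i.
Proof. by move=> lt; rewrite /cut lt. Qed.

Lemma w_cutS (i : 'I_n) : w (cut i.+1) = nth v0 s (ordS i).
Proof.
have [per _ _ _ _] := ew; rewrite /cut /=; case: (ltnP i.+1 n) => h; first by rewrite modn_small // wpos.
have -> : (i : nat).+1 = n by apply/eqP; rewrite eqn_leq h ltn_ord.
by rewrite modnn per wpos.
Qed.

(** The shift by [b] turns is needed for the last piece, which may run into the next turn. *)
Lemma cut_consecutive i v b : i < n -> ~ (cut i < pos v + b * m < cut i.+1).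
Proof.
move=> lt; pose j := index v s.
have jn : j < n by rewrite -ss index_mem.
have <- : nth v0 s j = v by rewrite nth_index.
rewrite /cut lt; case: (ltnP i.+1 n) => h /andP[h1 h2].
  case: b h1 h2 => [|b] h1 h2; last first.
    by have := posm (nth v0 s i.+1); rewrite mulSn in h2; lia.
  rewrite addn0 in h1 h2; case: (ltngtP i j) => ij.
  - case: (ltngtP i.+1 j) => ij'; [|lia|by rewrite ij' ltnn in h2].
    by have := pos_lt ij' jn; lia.
  - by have := pos_lt ij lt; lia.
  - by rewrite ij ltnn in h1.
have le0 : pos (nth v0 s 0) <= pos (nth v0 s j).
  by case: (posnP j) => [->//|j0]; apply/ltnW/pos_lt.
case: b h1 h2 => [|b] h1 h2; last by rewrite mulSn in h2; lia.
rewrite addn0 in h1; case: (ltngtP j i) => ij; [|lia|by rewrite ij ltnn in h1].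
by have := pos_lt ij lt; lia.
Qed.

(** A repetition at [x < y] closes a subwalk shorter than the tour, so some [u] occurs only strictly
    between them. Its picked occurrence would then lie strictly between consecutive cuts. *)
Lemma cut_uniq i : i < n -> uniq (w (cut i) :: tour_piece w (cut i) (cut i.+1 - cut i)).
Proof.
move=> lt; set d := cut i.+1 - cut i.
have -> : w (cut i) :: tour_piece w (cut i) d = [seq w k | k <- iota (cut i) d.+1] by [].
rewrite map_inj_in_uniq ?iota_uniq // => x y.
rewrite !mem_iota /d => hx hy.
have hc := cut_lt lt; have hs := cut_span lt.
wlog xy : x y hx hy / x < y => [hw|wxy].
  by case: (ltngtP x y) => // h wxy; [|symmetry]; apply: hw.
have [u hu] : exists u, forall k, k < m -> w (x + k) = u -> 0 < k < y - x.
  by apply: (closed_subwalk_private irr ew); [lia | rewrite subnKC // ltnW].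
have m0 : 0 < m by lia.
(* The number of turns that moves [pos u] into the window from [x] to [x + m - 1]. *)
pose b := (x + m - (pos u).+1) %/ m.
have um := posm u.
have hb1 : b * m <= x + m - (pos u).+1 := leq_divM _ _.
have hb2 : x + m - (pos u).+1 < b.+1 * m by rewrite -ltn_divLR.
rewrite mulSn in hb2.
have e : x + (pos u + b * m - x) = pos u + b * m by lia.
have : 0 < pos u + b * m - x < y - x.
  apply: hu; first lia.
  by rewrite e -(tour_modn _ ew) [pos u + _]addnC modnMDl tour_modn.
by move=> h; case: (@cut_consecutive i u b lt); lia.
Qed.

(** Laid end to end, the pieces form one full turn starting at [cut 0], which traverses each arc
    once. *)
Lemma cut_cover u v : (u, v) \in A ->
  \sum_(i < n) count_mem (u, v) [seq warc w k | k <- iota (cut i) (cut i.+1 - cut i)] = 1.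
Proof.
move=> uvA.
have tele j : j <= n -> \sum_(i < j) count_mem (u, v) [seq warc w k | k <- iota (cut i) (cut i.+1 - cut i)]
   = \sum_(k < cut j - cut 0) (warc w (cut 0 + k) == (u, v)).
  elim: j => [|j IH] jn; first by rewrite subnn !big_ord0.
  rewrite big_ord_recr /= IH ?(ltnW jn) //.
  have hc := cut_lt jn.
  have h0 : cut 0 <= cut j.
    elim: (j) (ltnW jn) => // j' IH' j'n; apply: leq_trans (IH' (ltnW j'n)) _.
    exact/ltnW/cut_lt.
  have -> : cut j.+1 - cut 0 = (cut j - cut 0) + (cut j.+1 - cut j) by lia.
  rewrite big_split_ord /=; congr (_ + _).
  rewrite -sum1_count big_map big_mkcond -{1}[cut j]addn0 iotaDl big_map.
  rewrite -[iota 0 _]val_enum_ord big_map big_enum /=; apply: eq_bigr => k _.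
  by rewrite addnA subnKC //; case: (_ == _).
rewrite tele // (_ : cut n - cut 0 = m); last first.
  by rewrite /cut ltnn (ltnW n1) addKn.
rewrite -(walk_set_sum (cut 0) (fun e => nat_of_bool (e == (u, v))) ew) //.
rewrite (bigD1 (u, v)) /= ?eqxx ?big1 // => [e /andP[_ /negPf->] //|].
have [_ _ _ /(_ _ uvA)[k km ->] _] := ew.
have c0 : cut 0 < m by rewrite /cut (ltnW n1).
apply/imsetP; have [h|h] := leqP (cut 0) k.
  have lt : k - cut 0 < m by lia.
  by exists (Ordinal lt); rewrite //= subnKC.
have lt : k + m - cut 0 < m by lia.
have hk : cut 0 <= k + m by lia.
exists (Ordinal lt); rewrite //= subnKC //.
by rewrite -(tour_arc_modn (k + m) ew) modnDr tour_arc_modn.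
Qed.

(** Gaps within a turn are at most [2 * l]. The last piece can also cross the incomplete segment: at
    worst it spans the last full segment, that remainder and the first segment. *)
Lemma cut_gap l : 0 < l ->
  (forall j, j < m %/ l -> exists v, j * l <= pos v < j.+1 * l) ->
  forall i, i < n -> cut i.+1 - cut i <= 3 * l.
Proof.
move=> l0 hl i lt; case: (ltnP i.+1 n) => h.
  have cm : cut i.+1 < m by rewrite /cut h.
  have := @increasing_gap m l (fun p => exists v, p = pos v) (cut i) (cut i.+1) l0 cm.
  have h1 j : j < m %/ l -> exists2 p, exists v, p = pos v & j * l <= p < j.+1 * l.
    by case/hl=> v hv; exists (pos v) => //; exists v.
  have h2 p : (exists v, p = pos v) -> ~ (cut i < p < cut i.+1).
    by move=> [v ->]; have := @cut_consecutive i v 0 lt; rewrite addn0.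
  by move=> /(_ h1 h2); lia.
have hs := cut_span lt; have hc := cut_lt lt.
have [k0|k0] := posnP (m %/ l).
  have : m < l by rewrite -[l]mul1n -ltn_divLR // k0.
  by lia.
have [v /andP[_ hv]] := hl 0 k0.
have lk : (m %/ l).-1 < m %/ l by lia.
have [u /andP[hu _]] := hl _ lk.
have mk : m < (m %/ l).+1 * l by rewrite -ltn_divLR.
have nv : ~ (cut i < pos v + 1 * m < cut i.+1) := @cut_consecutive i v 1 lt.
have nu : ~ (cut i < pos u + 0 * m < cut i.+1) := @cut_consecutive i u 0 lt.
have um := posm u.
have cS : m <= cut i.+1 by rewrite /cut ltnNge h /= leq_addl.
have cm : cut i < m by rewrite /cut lt.
have e : (m %/ l).+1 * l = (m %/ l).-1 * l + l + l by rewrite -{1}(prednK k0) !mulSn; lia.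
by lia.
Qed.
End Cut.

Lemma tour_decomposition (V : finType) (a : rel V) q :
  minimally_eulerian a -> 1 < #|V| -> #|V| <= q ^ 2 ->
  exists (ord : 'I_#|V| -> V) (P : 'I_#|V| -> seq V),
    [/\ bijective ord,
        forall i, dpath_from_to a (ord i) (ord (ordS i)) (P i),
        forall i, size (P i) <= 30 * q + 15 &
        forall u v, a u v ->
          \sum_(i < #|V|) count_mem (u, v) (walk_arcs (ord i) (P i)) = 1].
Proof.
move=> /minimally_eulerian_arcs; set A := [set e | _] => -[bA cA irr] n1 nq.
have q0 : 0 < q by case: q nq => //; rewrite exp0n // leqNgt (ltnW n1).
have [w ew] := euler_tour_exists n1 bA cA.
have [pos [posm wpos hl]] := spread_positions irr ew q0 nq.
have posI : injective pos by apply: (can_inj wpos).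
have [s [us ss sT srt]] := seq_sorted_by posI.
have [wA w_arc _ _ _] := ew.
pose c := cut A pos (w 0) s.
exists (fun i => nth (w 0) s i), (fun i : 'I_#|V| => tour_piece w (c i) (c i.+1 - c i)).
have wc (i : 'I_#|V|) : w (c i) = nth (w 0) s i by apply: w_cut.
have lec (i : 'I_#|V|) : c i <= c i.+1 by apply/ltnW/cut_lt.
split.
- apply: inj_card_bij; last by rewrite card_ord.
  by move=> i j /eqP; rewrite nth_uniq ?ss // => /eqP /val_inj.
- move=> i; split; [|split].
  + by rewrite -wc; apply: tour_piece_path => k; have := w_arc k; rewrite inE.
  + by rewrite -wc; apply: cut_uniq.
  + by rewrite -wc tour_piece_last subnKC // w_cutS.
- move=> i; rewrite size_map size_iota.
  have l0 : 0 < 10 * q + 5 by rewrite addn_gt0 orbT.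
  have -> : 30 * q + 15 = 3 * (10 * q + 5) by lia.
  exact: (cut_gap _ _ _ _ _ _ _ l0 hl).
- move=> u v uv; transitivity (\sum_(i < #|V|)
      count_mem (u, v) [seq warc w k | k <- iota (c i) (c i.+1 - c i)]).
    by apply: eq_bigr => i _; rewrite -wc tour_piece_arcs.
  by apply: cut_cover; rewrite ?inE.
Qed.

(** * The bound as a function of n *)

Local Open Scope R_scope.

Lemma Rceil_ge (z : Z) (x : R) : IZR z < x + 1 -> (z <= Rceil x)%Z.
Proof.
move=> zx; rewrite /Rceil; have [h _] := base_Int_part (- x).
suff : (z - 1 < - Int_part (- x))%Z by lia.
by apply: lt_IZR; rewrite minus_IZR opp_IZR; lra.
Qed.

Lemma ln2_gt0 : 0 < ln 2.
Proof. by rewrite -ln_1; apply: ln_increasing; lra. Qed.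

Lemma ln_le x y : 0 < x -> x <= y -> ln x <= ln y.
Proof.
move=> x0 [xy|->]; last exact: Rle_refl.
by apply/Rlt_le/ln_increasing.
Qed.

Lemma INR_expn2 (k : nat) : INR (2 ^ k)%N = 2 ^ k.
Proof. by elim: k => [|k IH] //; rewrite expnS mult_INR IH. Qed.

Lemma log2_ge (k n : nat) : (2 ^ k <= n)%N -> INR k <= log2 (INR n).
Proof.
move=> /leP/le_INR; rewrite INR_expn2 => h.
apply: (Rmult_le_reg_r (ln 2)); first exact: ln2_gt0.
rewrite /log2 /Rdiv Rmult_assoc Rinv_l; last by have := ln2_gt0; lra.
rewrite Rmult_1_r -ln_pow; last lra.
by apply: ln_le => //; apply: pow_lt; lra.
Qed.

Definition alpha := ln 2 / ln (3 / 2).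

(** From (3/2)^3 <= 2^2 and 2^7 <= (3/2)^12. These fractions suffice once the logarithm is at least
    12, because 12^3 >= 40^2 and 12^2 >= 2^7. *)
Lemma alpha_bounds : 3 / 2 <= alpha <= 12 / 7.
Proof.
have l0 : 0 < ln (3 / 2) by rewrite -ln_1; apply: ln_increasing; lra.
have h1 : INR 3 * ln (3 / 2) <= INR 2 * ln 2.
  by rewrite -!ln_pow; try lra; apply: ln_le; lra.
have h2 : INR 7 * ln 2 <= INR 12 * ln (3 / 2).
  by rewrite -!ln_pow; try lra; apply: ln_le; lra.
move: h1 h2; rewrite !INR_IZR_INZ /= => h1 h2.
have e : alpha * ln (3 / 2) = ln 2 by rewrite /alpha; field; lra.
by split; apply: (Rmult_le_reg_r (ln (3 / 2))) => //; rewrite e; lra.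
Qed.

Lemma Rpower_alpha_ge (L : R) : 12 <= L -> 40 <= Rpower L alpha.
Proof.
move=> L12; have [a1 a2] := alpha_bounds.
apply: Rle_trans (Rle_Rpower _ _ _ _ a1); last lra.
have h : INR 2 * ln 40 <= INR 3 * ln L.
  rewrite -!ln_pow; try lra; apply: ln_le; first lra.
  by apply: Rle_trans (pow_incr 12 L 3 _); lra.
move: h; rewrite !INR_IZR_INZ /= => h.
have -> : 40 = exp (ln 40) by rewrite exp_ln; lra.
by rewrite /Rpower; case: (Rle_lt_or_eq_dec (ln 40) (3 / 2 * ln L)) => [|/exp_increasing|->]; lra.
Qed.

Lemma Rpower_alpha_le (L : R) : 12 <= L -> Rpower L alpha <= 1 / 2 * L ^ 2.
Proof.
move=> L12; have [a1 a2] := alpha_bounds.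
have L0 : 0 < L by lra.
apply: Rle_trans (Rle_Rpower L alpha (12 / 7) _ a2) _; first lra.
have -> : L ^ 2 = Rpower L (12 / 7) * Rpower L (2 / 7).
  by rewrite -Rpower_plus -Rpower_pow // INR_IZR_INZ /=; congr Rpower; lra.
have h : 2 <= Rpower L (2 / 7).
  have h : INR 7 * ln 2 <= INR 2 * ln L.
    rewrite -!ln_pow; try lra; apply: ln_le; first lra.
    by apply: Rle_trans (pow_incr 12 L 2 _); lra.
  move: h; rewrite !INR_IZR_INZ /= => h.
  rewrite -[X in X <= _](exp_ln 2); last lra.
  rewrite /Rpower.
  by case: (Rle_lt_or_eq_dec (ln 2) (2 / 7 * ln L)) => [|/exp_increasing|->]; lra.
have := exp_pos (12 / 7 * ln L); rewrite -/(Rpower _ _); nra.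
Qed.

(** Below 4096 this is the largest value allowed. From 4096 on, where the logarithm is at least 12,
    it is the exact power, so the o(1) term can be zero. *)
Definition path_bound (n : nat) : R :=
  if (n < 4096)%N then 1 / 2 * log2 (INR n) ^ 2 else Rpower (log2 (INR n)) alpha.

Lemma path_bound_ge40 n : (2048 <= n)%N -> 40 <= path_bound n.
Proof.
rewrite /path_bound => n1; case: ltnP => n2.
  have := @log2_ge 11 n n1; rewrite INR_IZR_INZ /=; nra.
by apply: Rpower_alpha_ge; have := @log2_ge 12 n n2; rewrite INR_IZR_INZ.
Qed.

(** A path has at most n - 1 arcs, and the ceiling leaves room for one more unit; hence n - 2. *)
Lemma path_bound_small n : (1 < n)%N -> (n < 2048)%N ->
  INR n - 2 < path_bound n * sqrt (INR n).
Proof.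
move=> n1 n2; rewrite /path_bound (_ : n < 4096)%N; last by lia.
set L := log2 _; set x := sqrt _.
have n0 : 0 <= INR n by apply: pos_INR.
have xx : x * x = INR n by apply: sqrt_sqrt.
have x0 : 0 <= x by apply: sqrt_pos.
have nle k : (n <= k)%N -> INR n <= IZR (Z.of_nat k) by move=> /leP/le_INR; rewrite -INR_IZR_INZ.
have nge k : (k <= n)%N -> IZR (Z.of_nat k) <= INR n by move=> /leP/le_INR; rewrite -INR_IZR_INZ.
have x1 : 1 <= x by have := nge 1%N (ltnW n1); rewrite /=; nra.
(* The last condition gives 4 n < k^4, so 2 sqrt n <= k^2 <= L^2 and the right side is at least n.
   It holds for k from 3 to 10 and fails at 11, where the bound [40 * sqrt n] takes over. *)
have big k : (2 ^ k <= n)%N -> (n < 2 ^ k.+1)%N -> (2 ^ k.+3 <= k ^ 4)%N ->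
    INR n - 2 < 1 / 2 * L ^ 2 * x.
  move=> h1 h2 h3; have kL := log2_ge h1; have k0 := pos_INR k.
  have h : 2 * x <= INR k ^ 2.
    apply: Rnot_lt_le => h.
    have : INR (4 * n) < INR (k ^ 4).
      by apply/lt_INR/ltP; apply: leq_trans h3; move: h2; rewrite !expnS; lia.
    rewrite mult_INR (_ : (k ^ 4 = (k * k) * (k * k))%N); last by rewrite !mulnn -expnM.
    by rewrite !mult_INR !INR_IZR_INZ /= -!INR_IZR_INZ -xx; nra.
  have h' : INR k ^ 2 <= L ^ 2 by apply: pow_incr.
  by nra.
have [n8|n8] := leqP 8 n.
  have [h|h] := ltnP n 16; first by apply: (big 3%N).
  have [h'|h'] := ltnP n 32; first by apply: (big 4%N).
  have [h3|h3] := ltnP n 64; first by apply: (big 5%N).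
  have [h4|h4] := ltnP n 128; first by apply: (big 6%N).
  have [h5|h5] := ltnP n 256; first by apply: (big 7%N).
  have [h6|h6] := ltnP n 512; first by apply: (big 8%N).
  have [h7|h7] := ltnP n 1024; first by apply: (big 9%N).
  by apply: (big 10%N).
have [n4|n4] := leqP 4 n.
  have := @log2_ge 2 n n4; rewrite -/L INR_IZR_INZ /= => hL.
  have hL2 : 4 <= L ^ 2 by nra.
  have := nge 4%N n4; have := nle 7%N n8; rewrite /= => h7 h4.
  have : INR n - 2 < 2 * x by nra.
  by nra.
have [n3|n3] := leqP 3 n; last first.
  have -> : INR n = 2 by rewrite INR_IZR_INZ; congr IZR; lia.
  have := @log2_ge 1 n n1; rewrite -/L /= => hL; nra.
have e3 : INR n = 3 by rewrite INR_IZR_INZ; congr IZR; lia.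
have hL : 3 / 2 <= L.
  have h : INR 3 * ln 2 <= INR 2 * ln 3 by rewrite -!ln_pow; try lra; apply: ln_le; lra.
  move: h; rewrite /L /log2 e3 !INR_IZR_INZ /= => h.
  apply: (Rmult_le_reg_r (ln 2)); first exact: ln2_gt0.
  by rewrite /Rdiv [ln 3 * _ * _]Rmult_assoc Rinv_l; have := ln2_gt0; lra.
rewrite e3 in xx *; have hx : 3 / 2 <= x by nra.
by nra.
Qed.

Lemma length_bound_sqrt (n r d : nat) : (2048 <= n)%N -> (r * r <= n)%N ->
  (d <= 30 * r.+1 + 15)%N -> INR d <= 40 * sqrt (INR n).
Proof.
move=> /leP/le_INR + /leP/le_INR + /leP/le_INR.
rewrite plus_INR !mult_INR [INR r.+1]S_INR [INR 2048]INR_IZR_INZ [INR 30]INR_IZR_INZ [INR 15]INR_IZR_INZ /=.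
have x0 := sqrt_pos (INR n); have xx := sqrt_sqrt _ (pos_INR n); have r0 := pos_INR r.
move=> h1 h2 h3; have rx : INR r <= sqrt (INR n) by apply: Rnot_lt_le => h; nra.
have x10 : 10 <= sqrt (INR n) by apply: Rnot_lt_le => h; nra.
by lra.
Qed.

Theorem theorem2p1 :
  exists f : nat -> R,
    (forall n : nat, (1 < n)%N -> f n <= (1 / 2) * (log2 (INR n)) ^ 2) /\
    (exists e : nat -> R, Un_cv e 0 /\
       exists N : nat, forall n : nat, (N <= n)%N ->
         f n = Rpower (log2 (INR n)) (ln 2 / ln (3 / 2) + e n)) /\
    forall (V : finType) (a : rel V),
      simple_digraph a -> minimally_eulerian a -> (1 < #|V|)%N ->
      exists (ord : 'I_#|V| -> V) (P : 'I_#|V| -> seq V),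
        bijective ord /\
        (forall i : 'I_#|V|,
            dpath_from_to a (ord i) (ord (ordS i)) (P i) /\
            (Z.of_nat (size (P i)) <= Rceil (f #|V| * sqrt (INR #|V|)))%Z) /\
        (forall u v : V, a u v ->
            (\sum_(i < #|V|) count_mem (u, v) (walk_arcs (ord i) (P i)))%N = 1%N).
Proof.
exists path_bound; split; [|split].
- move=> n n1; rewrite /path_bound; case: ltnP => n2; first exact: Rle_refl.
  by apply: Rpower_alpha_le; have := @log2_ge 12 n n2; rewrite INR_IZR_INZ.
- exists (fun=> 0); split.
    by move=> eps eps0; exists 0%N => n _; rewrite R_dist_eq.
  by exists 4096%N => n hn; rewrite /path_bound ltnNge hn /= Rplus_0_r.
move=> V a _ mina n1.
pose r := Nat.sqrt #|V|; have [r1 r2] := Nat.sqrt_spec' #|V|.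
have nq : (#|V| <= r.+1 ^ 2)%N by rewrite -mulnn; apply/ltnW/ltP.
have [o [P [bo pP sP cP]]] := tour_decomposition mina n1 nq.
exists o, P; split=> //; split=> // i; split=> //; apply: Rceil_ge.
rewrite -INR_IZR_INZ; have [big|small] := leqP 2048 #|V|.
  have h40 := path_bound_ge40 big.
  have hs := length_bound_sqrt big (introT leP r1) (sP i).
  have x0 := sqrt_pos (INR #|V|).
  by apply: Rle_lt_trans hs _; nra.
have sn : (size (P i) < #|V|)%N.
  have [_ [/card_uniqP up _]] := pP i.
  by have := max_card (mem (o i :: P i)); rewrite up.
have := path_bound_small n1 small; have /ltP/le_INR := sn; rewrite S_INR; lra.
Qed.
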